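(* Let $F=\{n_F\}_{n\ge 0}$ be any cobweb-admissible sequence, and consider the infinite lower triangular matrix with entries $\binom{n}{k}_F$. Then the entries $\binom{n}{k}_F^{-1}$ of its inverse matrix are given by $\binom{n}{n}_F^{-1}=1$ and, for all $n,k\in\mathbb{N}$ with $n\neq k$, $$\binom{n}{k}_F^{-1}=\binom{n}{k}_F\left(\sum_{s=1}^{n-k}(-1)^s\sum_{\substack{k_1+k_2+\dots+k_s=n-k\\ k_1,k_2,\dots,k_s\ge 1}}\binom{n-k}{k_1,k_2,\dots,k_s}_F\right)=\sum_{s=1}^{n-k}(-1)^s\sum_{\substack{k_1+k_2+\dots+k_s=n-k\\ k_1,k_2,\dots,k_s\ge 1}}\binom{n}{k,k_1,k_2,\dots,k_s}_F .$$
   Context: $\mathbb{N}=\{1,2,3,\dots\}$. For a sequence $F=\{n_F\}_{n\ge0}$ of nonnegative integers with $n_F\ge 1$ for $n\geq 1$, put $n_F!=n_F\cdot(n-1)_F\cdots 1_F$ and $0_F!=1$. The $F$-nomial coefficients are $\binom{n}{k}_F=\frac{n_F!}{k_F!\,(n-k)_F!}$ for $0\le k\le n$, and $\binom{n}{k}_F=0$ for $k>n$. The sequence $F$ is cobweb-admissible if all $\binom{n}{k}_F$ are nonnegative integers. The multi $F$-nomial coefficient is $\binom{n}{k_1,\dots,k_s}_F=\frac{n_F!}{(k_1)_F!\cdots(k_s)_F!}$ when $k_1+\dots+k_s=n$. Here $\binom{n}{k}_F^{-1}$ denotes the $(n,k)$ entry of the inverse matrix (not a reciprocal), i.e. $\sum_{j=k}^{n}\binom{n}{j}_F\binom{j}{k}_F^{-1}=\delta_{n,k}$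 (Kronecker delta). Empty sums (in particular those occurring when $n<k$) are zero. *)

(* Defs.v *)
From mathcomp Require Import all_boot all_order all_algebra.
Set Implicit Arguments.
Unset Strict Implicit.
Unset Printing Implicit Defensive.
Import Order.TTheory GRing.Theory Num.Theory.

Local Open Scope ring_scope.

Definition Ffact (F : nat -> nat) (n : nat) : nat :=
  (\prod_(1 <= i < n.+1) F i)%N.

(* The quotient is taken in rat: its integrality is the content of
   cobweb-admissibility. *)
Definition Fnomial (F : nat -> nat) (n k : nat) : rat :=
  if (k <= n)%N then
    (Ffact F n)%:R / ((Ffact F k)%:R * (Ffact F (n - k)%N)%:R)
  else 0.

Definition cobweb_admissible (F : nat -> nat) : Prop :=
  forall n k : nat, Fnomial F n k \is a Num.nat.

(* Only meaningful when the entries of ks sum to n. *)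
Definition Fmultinomial (F : nat -> nat) (n : nat) (ks : seq nat) : rat :=
  (Ffact F n)%:R / \prod_(k <- ks) (Ffact F k)%:R.

Definition is_composition (m : nat) (ks : seq nat) : bool :=
  all (fun k => 0 < k)%N ks && (sumn ks == m).

(* Sum of f over all (k_1, ..., k_s) with every k_i >= 1 and sum m; each such
   k_i is at most m, so the tuples over 'I_m.+1 exhaust them. *)
Definition composition_sum (m s : nat) (f : seq nat -> rat) : rat :=
  \sum_(t : s.-tuple 'I_m.+1 | is_composition m (map val t)) f (map val t).

Definition lower_triangular (A : nat -> nat -> rat) : Prop :=
  forall n k : nat, (n < k)%N -> A n k = 0.

(* B is the inverse of A among infinite lower triangular matrices. The sum is
   empty for n < k, so those entries of B are fixed by triangularity alone. *)
Definition lower_inverse (A B : nat -> nat -> rat) : Prop :=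
  lower_triangular B /\
  forall n k : nat, \sum_(k <= j < n.+1) A n j * B j k = (n == k)%:R.

(* Main.v *)
Require Import Defs.
From mathcomp Require Import all_boot all_order all_algebra.
Set Implicit Arguments.
Unset Strict Implicit.
Unset Printing Implicit Defensive.
Import Order.TTheory GRing.Theory Num.Theory.

Local Open Scope ring_scope.

(** The F-factorials enter only through the sequence a m = 1 / m_F!, and up to
    the row factor n_F! and the column factor 1 / k_F! the F-nomial matrix is
    the Toeplitz matrix of a.  Inverting it therefore means inverting the
    power series 1 + p, where p is the sum of the a j x^j with j >= 1.  The
    geometric series sum over s of (-1)^s p^s does this, and the coefficient of
    x^m in p^s is, by expansion of the product, the sum over the compositions
    of m into s positive parts of the products of the a k_i.

    In place of power series the argument uses the rule p^(s+1) = p p^s on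
    coefficients, which is splitting off the first part of a composition
    ([composition_sumS]).  As a composition of m has at most m parts, the
    geometric series is a finite sum at each degree ([conv_invE]), and
    [conv_invK] states that it inverts a for the convolution product.
    Uniqueness of the inverse is the usual forward substitution for
    unitriangular matrices ([lower_inverse_unique]). *)

(** * Sums over compositions *)

(** [composition_sum] with the bound on the parts decoupled from the total:
    removing a first part decreases the total but leaves the type of the
    remaining parts unchanged, so only this form can be unfolded by induction
    on the number of parts. *)
Definition bounded_composition_sum (N m s : nat) (f : seq nat -> rat) : rat :=
  \sum_(t : s.-tuple 'I_N.+1 | is_composition m (map val t)) f (map val t).

Lemma bounded_composition_sum0 N m f :
  bounded_composition_sum N m 0 f = if m == 0%N then f [::] else 0.
Proof.
rewrite /bounded_composition_sum.
case: eqP => [->|/eqP m_neq0].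
  rewrite (big_pred1 [tuple]) //= => t.
  by rewrite (tuple0 t); apply/esym/eqP.
rewrite big_pred0 // => t.
by rewrite (tuple0 t) /is_composition /= eq_sym (negbTE m_neq0).
Qed.

Lemma is_composition_cons m k ks :
  is_composition m (k :: ks) =
  (0 < k <= m)%N && is_composition (m - k) ks.
Proof.
rewrite /is_composition /= -!andbA; congr (_ && _).
rewrite [RHS]andbCA; congr (_ && _).
case: leqP => [le_km|lt_mk] /=.
  by rewrite -{1}(subnKC le_km) eqn_add2l.
by apply/negbTE; rewrite gtn_eqF // (leq_trans lt_mk) ?leq_addr.
Qed.

Lemma bounded_composition_sumS N m s f : (m <= N)%N ->
  bounded_composition_sum N m s.+1 f =
  \sum_(1 <= j < m.+1)
     bounded_composition_sum N (m - j) s (fun ks => f (j :: ks)).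
Proof.
move=> le_mN; rewrite /bounded_composition_sum.
pose cons_pair (p : 'I_N.+1 * s.-tuple 'I_N.+1) := [tuple of p.1 :: p.2].
pose uncons (t : s.+1.-tuple 'I_N.+1) := (thead t, [tuple of behead t]).
have consK : cancel cons_pair uncons.
  by case=> x t; rewrite /uncons theadE; congr (_, _); apply: val_inj.
have unconsK : cancel uncons cons_pair.
  by move=> t; rewrite [RHS]tuple_eta.
rewrite (reindex cons_pair) /=; last by exists uncons => t _.
under eq_bigl => p do rewrite is_composition_cons.
rewrite -(pair_big_dep (fun x : 'I_N.+1 => 0 < x <= m)%N
  (fun x (t : s.-tuple _) => is_composition (m - x) (map val t))
  (fun x (t : s.-tuple _) => f (val x :: map val t))) /=.
pose g j := bounded_composition_sum N (m - j) s (fun ks => f (j :: ks)).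
rewrite -(big_mkord (fun j => 0 < j <= m)%N g).
rewrite (big_nat_widen 1 m.+1 N.+1) // big_ltn_cond //=.
rewrite [RHS]big_mkcond [LHS]big_mkcond /=.
by apply: eq_big_nat => j /andP[j_gt0 _]; rewrite j_gt0 ltnS.
Qed.

Lemma bounded_composition_sumE N m s f : (m <= N)%N ->
  bounded_composition_sum N m s f = composition_sum m s f.
Proof.
rewrite -[RHS]/(bounded_composition_sum m m s f).
suff widen M : (m <= M)%N -> (m <= N)%N ->
    bounded_composition_sum N m s f = bounded_composition_sum M m s f.
  exact: widen.
elim: s => [|s IHs] in m f *; first by rewrite !bounded_composition_sum0.
move=> le_mM le_mN; rewrite !bounded_composition_sumS //.
apply: eq_bigr => j _.
by apply: IHs; apply: leq_trans (leq_subr _ _) _.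
Qed.

Lemma composition_sum0 m f :
  composition_sum m 0 f = if m == 0%N then f [::] else 0.
Proof. exact: (bounded_composition_sum0 m m f). Qed.

Lemma composition_sumS m s f :
  composition_sum m s.+1 f =
  \sum_(1 <= j < m.+1) composition_sum (m - j) s (fun ks => f (j :: ks)).
Proof.
rewrite -[LHS]/(bounded_composition_sum m m s.+1 f) bounded_composition_sumS //.
by apply: eq_bigr => j _; rewrite bounded_composition_sumE ?leq_subr.
Qed.

Lemma composition_sum_gt m s f : (m < s)%N -> composition_sum m s f = 0.
Proof.
elim: s => // s IHs in m f *; rewrite ltnS => le_ms.
rewrite composition_sumS big_nat big1 // => j /andP[j_gt0 le_jm].
by apply: IHs; apply: leq_trans le_ms; rewrite ltn_subrL j_gt0 (leq_trans j_gt0).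
Qed.

Lemma composition_sumZ c m s f :
  composition_sum m s (fun ks => c * f ks) = c * composition_sum m s f.
Proof. by rewrite /composition_sum mulr_sumr. Qed.

Lemma eq_composition_sum m s f g :
  f =1 g -> composition_sum m s f = composition_sum m s g.
Proof. by move=> eq_fg; apply: eq_bigr. Qed.

(** * Inversion for the convolution product *)

(** The coefficient of x^m in p^s, for p the sum of the a j x^j with j >= 1. *)
Definition conv_pow (a : nat -> rat) (s m : nat) : rat :=
  composition_sum m s (fun ks => \prod_(k <- ks) a k).

(** The coefficient of x^m in 1 / (1 + p); the terms with s > m of the
    geometric series have order larger than m. *)
Definition conv_inv (a : nat -> rat) (m : nat) : rat :=
  \sum_(0 <= s < m.+1) (-1) ^+ s * conv_pow a s m.

Lemma conv_pow0 a m : conv_pow a 0 m = (m == 0%N)%:R.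
Proof. by rewrite /conv_pow composition_sum0 big_nil; case: eqP. Qed.

Lemma conv_powS a s m :
  conv_pow a s.+1 m = \sum_(1 <= j < m.+1) a j * conv_pow a s (m - j).
Proof.
rewrite /conv_pow composition_sumS; apply: eq_bigr => j _.
rewrite -composition_sumZ; apply: eq_composition_sum => ks.
by rewrite big_cons.
Qed.

(** A cutoff that does not depend on m lets the coefficients of different
    degrees be combined termwise in s. *)
Lemma conv_invE a m M : (m < M)%N ->
  conv_inv a m = \sum_(0 <= s < M) (-1) ^+ s * conv_pow a s m.
Proof.
move=> lt_mM; rewrite /conv_inv (big_cat_nat (leq0n m.+1) lt_mM) /=.
rewrite [X in _ = _ + X]big_nat [X in _ = _ + X]big1 ?addr0 // => s /andP[lt_ms _].
by rewrite /conv_pow composition_sum_gt // mulr0.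
Qed.

Lemma conv_inv0 a : conv_inv a 0 = 1.
Proof. by rewrite /conv_inv big_nat1 conv_pow0 mulr1. Qed.

Lemma conv_inv_pos a m : (0 < m)%N ->
  conv_inv a m = \sum_(1 <= s < m.+1) (-1) ^+ s * conv_pow a s m.
Proof.
move=> m_gt0; rewrite /conv_inv big_ltn // conv_pow0.
by rewrite eqn0Ngt m_gt0 mulr0 add0r.
Qed.

(** The identity 1 / (1 + p) = 1 - p / (1 + p), in degree m > 0. *)
Lemma conv_inv_rec a m : (0 < m)%N ->
  conv_inv a m = - \sum_(1 <= j < m.+1) a j * conv_inv a (m - j).
Proof.
move=> m_gt0; rewrite conv_inv_pos // big_add1 /=.
under eq_bigr => s _ do rewrite conv_powS exprS mulN1r mulNr mulr_sumr.
rewrite sumrN exchange_big /=; congr (- _).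
apply: eq_big_nat => j /andP[j_gt0 _].
rewrite (@conv_invE a _ m) ?ltn_subrL ?j_gt0 // mulr_sumr.
by apply: eq_bigr => s _; rewrite mulrCA.
Qed.

Lemma conv_invK a m : a 0%N = 1 ->
  \sum_(0 <= j < m.+1) a j * conv_inv a (m - j) = (m == 0%N)%:R.
Proof.
move=> a0; rewrite big_ltn // a0 mul1r subn0.
case: (posnP m) => [->|m_gt0]; first by rewrite big_geq // conv_inv0 addr0.
by rewrite conv_inv_rec // addNr.
Qed.

(** * Inverses of unitriangular matrices *)

Lemma lower_inverse_unique A B B' : (forall n, A n n = 1) ->
  lower_inverse A B -> lower_inverse A B' -> forall n k, B n k = B' n k.
Proof.
move=> A1 [triB invB] [triB' invB'] n k.
elim/ltn_ind: n => n IHn.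
case: (ltnP n k) => [lt_nk|le_kn]; first by rewrite triB // triB'.
have := etrans (invB n k) (esym (invB' n k)).
rewrite !(big_nat_recr n k) //= A1 !mul1r.
have -> : \sum_(k <= j < n) A n j * B j k = \sum_(k <= j < n) A n j * B' j k.
  by apply: eq_big_nat => j /andP[_ lt_jn]; rewrite IHn.
exact: addrI.
Qed.

(** * The inverse of the F-nomial matrix *)

Definition inv_Ffact (F : nat -> nat) (m : nat) : rat := (Ffact F m)%:R^-1.

Definition Fnomial_inv (F : nat -> nat) (n k : nat) : rat :=
  if (k <= n)%N then
    (Ffact F n)%:R * inv_Ffact F k * conv_inv (inv_Ffact F) (n - k)
  else 0.

Lemma inv_Ffact0 F : inv_Ffact F 0 = 1.
Proof. by rewrite /inv_Ffact /Ffact big_geq ?invr1. Qed.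

Lemma FmultinomialE F n ks :
  Fmultinomial F n ks = (Ffact F n)%:R * \prod_(k <- ks) inv_Ffact F k.
Proof. by rewrite /Fmultinomial -prodfV. Qed.

Lemma composition_sum_Fmultinomial F n m s :
  composition_sum m s (fun ks => Fmultinomial F n ks) =
  (Ffact F n)%:R * conv_pow (inv_Ffact F) s m.
Proof.
rewrite -composition_sumZ; apply: eq_composition_sum => ks.
exact: FmultinomialE.
Qed.

Lemma composition_sum_Fmultinomial_cons F n k m s :
  composition_sum m s (fun ks => Fmultinomial F n (k :: ks)) =
  (Ffact F n)%:R * inv_Ffact F k * conv_pow (inv_Ffact F) s m.
Proof.
rewrite -composition_sumZ; apply: eq_composition_sum => ks.
by rewrite FmultinomialE big_cons mulrA.
Qed.

Section PositiveSequence.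

Variable F : nat -> nat.
Hypothesis Fpos : forall n : nat, (1 <= n)%N -> (1 <= F n)%N.

Lemma Ffact_neq0 n : (Ffact F n)%:R != 0 :> rat.
Proof.
rewrite pnatr_eq0 -lt0n /Ffact big_nat prodn_cond_gt0 // => i /andP[i_gt0 _].
exact: Fpos.
Qed.

Lemma Fnomial_diag n : Fnomial F n n = 1.
Proof.
rewrite /Fnomial leqnn subnn invfM -/(inv_Ffact F 0) inv_Ffact0.
by rewrite mulr1 divff ?Ffact_neq0.
Qed.

Lemma Fnomial_inv_diag n : Fnomial_inv F n n = 1.
Proof.
by rewrite /Fnomial_inv leqnn subnn conv_inv0 mulr1 divff ?Ffact_neq0.
Qed.

(** In the product of the two matrices the j_F! of the rows of one cancels the
    1 / j_F! of the columns of the other, which leaves a convolution of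
    length n - k. *)
Lemma Fnomial_inv_lower_inverse : lower_inverse (Fnomial F) (Fnomial_inv F).
Proof.
split=> [n k lt_nk|n k]; first by rewrite /Fnomial_inv leqNgt lt_nk.
case: (ltnP n k) => [lt_nk|le_kn].
  by rewrite big_geq // ltn_eqF.
pose a := inv_Ffact F.
have termE j : (k <= j < n.+1)%N -> Fnomial F n j * Fnomial_inv F j k =
    (Ffact F n)%:R * a k * (a (n - j)%N * conv_inv a (j - k)).
  rewrite ltnS => /andP[le_kj le_jn].
  rewrite /Fnomial /Fnomial_inv le_kj le_jn invfM -!/(inv_Ffact F _) -/a.
  have ajK : a j * (Ffact F j)%:R = 1 by rewrite mulVf ?Ffact_neq0.
  rewrite -!mulrA; congr (_ * _).
  by rewrite (mulrCA (a (n - j)%N)) (mulrA (a j)) ajK mul1r mulrCA.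
rewrite (eq_big_nat _ _ termE) -mulr_sumr.
have -> : \sum_(k <= j < n.+1) a (n - j)%N * conv_inv a (j - k) =
    ((n - k)%N == 0%N)%:R.
  (* The index of the convolution is n - j. *)
  rewrite -(conv_invK _ (inv_Ffact0 F)) -/a big_nat_rev /=.
  rewrite -{1}[k]add0n big_addn subSn //.
  apply: eq_big_nat => j /andP[_]; rewrite ltnS => le_j.
  have -> : (k + n.+1 - (j + k).+1 = n - j)%N.
    by rewrite addnC addSn subSS subnDr.
  rewrite subKn; last by apply: leq_trans le_j (leq_subr _ _).
  by rewrite subnAC.
rewrite subn_eq0.
have [<-|neq_nk] := eqVneq n k.
  by rewrite leqnn mulr1 /a divff ?Ffact_neq0.
by rewrite leqNgt ltn_neqAle le_kn eq_sym neq_nk mulr0.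
Qed.

Lemma Fnomial_inv_multinomial n k : n <> k ->
  Fnomial_inv F n k =
  \sum_(1 <= s < (n - k).+1)
     (-1) ^+ s * composition_sum (n - k) s
                   (fun ks => Fmultinomial F n (k :: ks)).
Proof.
move=> /eqP neq_nk; rewrite /Fnomial_inv; case: leqP => [le_kn|lt_nk]; last first.
  by rewrite big_geq // ltnS leqn0 subn_eq0 ltnW.
have lt_kn : (k < n)%N by rewrite ltn_neqAle eq_sym neq_nk.
rewrite conv_inv_pos ?subn_gt0 // mulr_sumr; apply: eq_bigr => s _.
by rewrite composition_sum_Fmultinomial_cons mulrCA.
Qed.

Lemma Fnomial_mul_Fmultinomial n k s : (k <= n)%N ->
  Fnomial F n k * composition_sum (n - k) s
                    (fun ks => Fmultinomial F (n - k) ks) =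
  composition_sum (n - k) s (fun ks => Fmultinomial F n (k :: ks)).
Proof.
move=> le_kn; rewrite composition_sum_Fmultinomial.
rewrite composition_sum_Fmultinomial_cons /Fnomial le_kn invfM !mulrA.
by rewrite mulfVK ?Ffact_neq0.
Qed.

End PositiveSequence.

Theorem theorem2 (F : nat -> nat)
  (Fpos : forall n : nat, (1 <= n)%N -> (1 <= F n)%N)
  (Fadm : cobweb_admissible F) :
  exists G : nat -> nat -> rat,
    [/\ lower_inverse (Fnomial F) G,
        forall G' : nat -> nat -> rat,
          lower_inverse (Fnomial F) G' -> forall n k : nat, G' n k = G n k,
        forall n : nat, G n n = 1
      & forall n k : nat, (1 <= n)%N -> (1 <= k)%N -> n <> k ->
          G n k = Fnomial F n k *
            (\sum_(1 <= s < (n - k).+1)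
               (-1) ^+ s * composition_sum (n - k) s
                             (fun ks => Fmultinomial F (n - k) ks))
          /\
          G n k =
            \sum_(1 <= s < (n - k).+1)
               (-1) ^+ s * composition_sum (n - k) s
                             (fun ks => Fmultinomial F n (k :: ks))].
Proof.
exists (Fnomial_inv F); split.
- exact: Fnomial_inv_lower_inverse.
- move=> G' invG'.
  apply: lower_inverse_unique invG' (Fnomial_inv_lower_inverse Fpos).
  exact: Fnomial_diag.
- exact: Fnomial_inv_diag.
move=> n k _ _ neq_nk; rewrite Fnomial_inv_multinomial //; split=> //.
case: (leqP k n) => [le_kn|lt_nk]; last first.
  by rewrite /Fnomial leqNgt lt_nk mul0r big_geq // ltnS leqn0 subn_eq0 ltnW.
rewrite mulr_sumr; apply: eq_bigr => s _.
by rewrite mulrCA Fnomial_mul_Fmultinomial.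
Qed.
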